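(* Let $\Gamma$ be a canonical signed unicyclic graph with girth $g$ whose unique signed cycle is $C_g^\sigma$. Let $w_1,\dots,w_k$ ($k\ge 0$) be the major vertices of $\Gamma$, listed in cyclic order along $C_g^\sigma$, and for $k\ge1$ let $P_1,\dots,P_k$ be the (possibly empty) paths obtained by deleting all attached pendant stars from $\Gamma$, where $P_j$ consists of the cycle vertices strictly between $w_j$ and $w_{j+1}$ (indices mod $k$); its order is its number of vertices (the empty path has order $0$, which counts as even). Then: (1) If $g\equiv 1,3 \pmod 4$, then $i_-(\Gamma)=\lceil \frac{g}{2}\rceil+1$ if and only if $\Gamma$ has at least three attached pendant stars (i.e. $k\ge 3$) and exactly three of the paths $P_1,\dots,P_k$ between consecutive major vertices have even order. (2) If $g\equiv 0,2 \pmod 4$, then $i_-(\Gamma)=\lceil \frac{g}{2}\rceil+1$ if and only if $\Gamma$ has at least two attached pendant stars (i.e. $k\ge 2$) and exactly two of the paths $P_1,\dots,P_k$ between consecutive major vertices have even order.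
   Context: A signed graph $\Gamma=(G,\sigma)$ is a simple graph $G$ with a sign function $\sigma:E(G)\to\{+,-\}$; its adjacency matrix $A(\Gamma)$ has $(u,v)$-entry $\sigma(uv)$ if $uv\in E(G)$ and $0$ otherwise, and $i_-(\Gamma)$ (the negative inertia index) is the number of negative eigenvalues of $A(\Gamma)$. The girth is the length of a shortest cycle. A signed unicyclic graph $\Gamma$ with unique cycle $C^\sigma$ is called canonical if every vertex not on $C^\sigma$ is at distance exactly $1$ from $C^\sigma$, the set of vertices at distance $1$ from $C^\sigma$ is independent, and each such vertex is adjacent to exactly one vertex of $C^\sigma$ (so every vertex off the cycle is a pendant vertex attached to the cycle). A major vertex is a vertex of $C^\sigma$ having at least one neighbour off the cycle; the attached pendant star at a major vertex $w$ is the induced star consisting of $w$ (its center) and all neighbours of $w$ not on $C^\sigma$. *)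

(* Defs.v *)
From mathcomp Require Import all_boot all_order all_algebra all_field.

Set Implicit Arguments.
Unset Strict Implicit.
Unset Printing Implicit Defensive.

Import Order.TTheory GRing.Theory Num.Theory.

Record simple_graph (V : finType) := SimpleGraph {
  adj : rel V;
  adj_sym : symmetric adj;
  adj_irrefl : irreflexive adj
}.

(* An edge uv is the unordered pair [set u; v]. The sign function is total on  *)
(* {set V}, but only its values on edges are ever used; true stands for -.     *)
Record signed_graph (V : finType) := SignedGraph {
  underlying :> simple_graph V;
  is_negative : {set V} -> bool
}.

Definition adjacency_mx (V : finType) (G : signed_graph V) : 'M[algC]_#|V| :=
  (\matrix_(i, j)
     let u := enum_val i in let v := enum_val j in
     if adj G u v then (-1) ^+ is_negative G [set u; v] else 0)%R.

(* All roots of the characteristic polynomial, with algebraic multiplicity.    *)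
Definition eigenvalues (n : nat) (A : 'M[algC]_n) : seq algC :=
  sval (closed_field_poly_normal (char_poly A)).

Definition negative_inertia (V : finType) (G : signed_graph V) : nat :=
  count (fun x : algC => (x < 0)%R) (eigenvalues (adjacency_mx G)).

Section Graphs.
Variables (V : finType) (G : simple_graph V).

Definition connected : Prop := forall u v : V, connect (adj G) u v.

(* A cycle is given by its vertices in cyclic order; two such sequences denote *)
(* the same cycle (up to rotation and reversal) iff they have the same edges.  *)
Definition is_cycle (c : seq V) : bool :=
  [&& 2 < size c, uniq c & cycle (adj G) c].

Definition cycle_edges (c : seq V) : {set {set V}} :=
  [set [set x; next c x] | x in c].

Definition is_girth (g : nat) : Prop :=
  (exists2 c, is_cycle c & size c = g) /\
  (forall c, is_cycle c -> g <= size c).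

Definition unicyclic : Prop :=
  connected /\
  exists2 c, is_cycle c &
    forall c', is_cycle c' -> cycle_edges c' = cycle_edges c.

Definition walk_to (c : seq V) (v : V) (d : nat) : Prop :=
  exists p, [/\ path (adj G) v p, last v p \in c & size p = d].

Definition at_distance (c : seq V) (v : V) (d : nat) : Prop :=
  walk_to c v d /\ (forall d', walk_to c v d' -> d <= d').

Definition canonical (c : seq V) : Prop :=
  [/\ forall v, v \notin c -> at_distance c v 1,
      forall u v, at_distance c u 1 -> at_distance c v 1 -> ~~ adj G u v
    & forall v, at_distance c v 1 -> #|[set u in c | adj G v u]| = 1].

Definition major (c : seq V) (w : V) : bool :=
  (w \in c) && [exists v, (v \notin c) && adj G w v].

(* Listed in the cyclic order given by c.                                      *)
Definition majors (c : seq V) : seq V := [seq w <- c | major c w].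

Definition pendant_star (c : seq V) (w : V) : {set V} :=
  w |: [set v | (v \notin c) && adj G w v].

Definition pendant_stars (c : seq V) : seq {set V} :=
  [seq pendant_star c w | w <- majors c].

(* The vertices met after x and before the next occurrence of y when going     *)
(* around c. For y = x this is all of c except x (whereas arc c x x is empty), *)
(* as required when there is a single major vertex.                            *)
Definition strictly_between (c : seq V) (x y : V) : seq V :=
  let p := behead (rot (index x c) c) in take (index y p) p.

Definition major_paths (c : seq V) : seq (seq V) :=
  [seq strictly_between c w (next (majors c) w) | w <- majors c].

Definition num_even_paths (c : seq V) : nat :=
  count (fun P => ~~ odd (size P)) (major_paths c).

End Graphs.

(* Main.v *)
Require Import Defs.
From mathcomp Require Import all_boot all_order all_algebra all_field.
From mathcomp Require Import ring zify.

(* Deleting a pendant vertex together with its neighbour lowers the negative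
   inertia by exactly one, and an edgeless graph has negative inertia 0.  Going
   once around the cycle from a major vertex, delete each major vertex (paired
   with one of its leaves) and every second vertex of each path between majors
   (paired with its predecessor): the k major vertices and the floor (|P_j| / 2)
   pairs of each path account for all of the negative inertia, so that
   2 i_-(G) = g + (number of even paths).  Without major vertices, deleting one
   vertex of the cycle lowers the negative inertia by at most one, which gives
   2 i_-(G) <= g + 1. *)

Set Implicit Arguments.
Unset Strict Implicit.
Unset Printing Implicit Defensive.

Import Order.TTheory GRing.Theory Num.Theory.

(** * Hermitian matrices: negative inertia as the largest dimension of a negative definite
    subspace *)

Section Inertia.
Local Open Scope ring_scope.
Local Open Scope sesquilinear_scope.

Definition neg_inertia (n : nat) (A : 'M[algC]_n) : nat :=
  count (fun x : algC => x < 0) (eigenvalues A).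

Definition sqform (n : nat) (A : 'M[algC]_n) (x : 'rV[algC]_n) : algC :=
  (x *m A *m x ^t*) 0 0.

(** A nonzero [u] with [u *m W = 0] would give the value 0, so the rows of [W] are independent and
    span a [k]-dimensional negative definite subspace. *)
Definition neg_definite_on (n k : nat) (A : 'M[algC]_n) (W : 'M[algC]_(k, n)) :=
  forall u : 'rV_k, u != 0 -> sqform A (u *m W) < 0.

Lemma trmxC_mul (m n p : nat) (A : 'M[algC]_(m, n)) (B : 'M[algC]_(n, p)) :
  (A *m B) ^t* = B ^t* *m A ^t*.
Proof. by rewrite trmx_mul map_mxM. Qed.

Lemma sqform_congr (m n : nat) (A : 'M[algC]_n) (M : 'M_(m, n)) x :
  sqform A (x *m M) = sqform (M *m A *m M ^t*) x.
Proof. by rewrite /sqform trmxC_mul !mulmxA. Qed.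

Lemma char_poly_similar (n : nat) (P A B : 'M[algC]_n) :
  P \in unitmx -> P *m A = B *m P -> char_poly A = char_poly B.
Proof.
move=> Pu PA; rewrite /char_poly.
have /(congr1 determinant) : map_mx polyC P *m char_poly_mx A =
    char_poly_mx B *m map_mx polyC P.
  by rewrite mulmxBr mulmxBl scalar_mxC -!map_mxM PA.
rewrite !det_mulmx mulrC => /mulIf; apply.
by rewrite det_map_mx polyC_eq0 -unitfE -unitmxE.
Qed.

Lemma eigenvalues_diag (n : nat) (A P : 'M[algC]_n) (d : 'rV_n) :
  P \in unitmx -> P *m A = diag_mx d *m P ->
  perm_eq (eigenvalues A) [seq d 0 i | i <- enum 'I_n].
Proof.
move=> Pu PA; apply: prod_XsubC_eq; rewrite big_map big_enum /=.
rewrite -[LHS]scale1r -(monicP (char_poly_monic A)).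
rewrite -(svalP (closed_field_poly_normal (char_poly A))).
rewrite (char_poly_similar Pu PA) char_poly_trig ?diag_mx_is_trig //.
by apply: eq_bigr => i _; rewrite mxE eqxx.
Qed.

Lemma neg_inertia_diag (n : nat) (A P : 'M[algC]_n) (d : 'rV_n) :
  P \in unitmx -> P *m A = diag_mx d *m P ->
  neg_inertia A = #|[set i | d 0 i < 0]|.
Proof.
move=> Pu PA; rewrite /neg_inertia (permP (eigenvalues_diag Pu PA)).
rewrite count_map -size_filter cardsE cardE; congr size.
by rewrite /enum_mem -filter_predI; apply: eq_filter => i; rewrite /= andbT.
Qed.

Lemma sqform_diag (n : nat) (d x : 'rV_n) :
  sqform (diag_mx d) x = \sum_i d 0 i * `|x 0 i| ^+ 2.
Proof.
rewrite /sqform mxE; apply: eq_bigr => i _.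
rewrite mul_mx_diag !mxE normCK mulrAC mulrA [d 0 i * _]mulrC -!mulrA.
by rewrite [_^* * _]mulrC.
Qed.

Lemma hermitian_diag (n : nat) (A : 'M[algC]_n) : A ^t* = A ->
  {P : 'M[algC]_n & {d : 'rV_n |
    [/\ P *m P ^t* = 1%:M, A = P ^t* *m diag_mx d *m P
      & forall i, d 0 i \is Num.real]}}.
Proof.
move=> Ah; exists (spectralmx A), (spectral_diag A).
have Pu := spectral_unitarymx A.
have hA : A \is hermsymmx by apply/is_hermitianmxP; rewrite expr0 scale1r Ah.
split; first exact/unitarymxP.
  by rewrite -invmx_unitary //; apply/orthomx_spectralP/hermitian_normalmx.
by move=> i; apply: (mxOverP (hermitian_spectral_diag_real hA)).
Qed.

(** The rows of the diagonalizing [P] that belong to negative eigenvalues span such a subspace. *)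
Lemma exists_neg_definite (n : nat) (A : 'M[algC]_n) : A ^t* = A ->
  exists W : 'M_(neg_inertia A, n), neg_definite_on A W.
Proof.
move=> /hermitian_diag [P [d [PPt defA _]]].
have Pu := unitarymx_unit (introT unitarymxP PPt).
have PA : P *m A = diag_mx d *m P by rewrite defA !mulmxA PPt mul1mx.
rewrite (neg_inertia_diag Pu PA); set J := [set i | _].
pose S : 'M[algC]_(#|J|, n) := \matrix_(a, i) (enum_val a == i)%:R.
exists (S *m P) => u u0.
have uSE a : (u *m S) 0 (enum_val a) = u 0 a.
  rewrite mxE (bigD1 a) //= mxE eqxx mulr1 big1 ?addr0 // => b ba.
  by rewrite mxE (inj_eq enum_val_inj) (negPf ba) mulr0.
have uS0 i : i \notin J -> (u *m S) 0 i = 0.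
  move=> iJ; rewrite mxE big1 // => b _; rewrite mxE.
  by case: eqP => [eqi|_]; [rewrite -eqi enum_valP in iJ | rewrite mulr0].
rewrite mulmxA sqform_congr PA -mulmxA PPt mulmx1 sqform_diag.
have [a ua0] : exists a, u 0 a != 0.
  apply/existsP; move: u0; apply: contraNT => /existsPn u0; apply/eqP/rowP => a.
  by rewrite mxE; apply/eqP; rewrite -[_ == _]negbK u0.
have dJ (b : 'I_#|J|) : d 0 (enum_val b) < 0 by have := enum_valP b; rewrite inE.
rewrite (bigD1 (enum_val a)) //= uSE -[ltRHS]addr0 ltr_leD //.
  by rewrite nmulr_rlt0 // exprn_gt0 // normr_gt0.
apply: sumr_le0 => i _; have [iJ|/uS0 ->] := boolP (i \in J).
  by rewrite inE in iJ; rewrite nmulr_rle0 // exprn_ge0.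
by rewrite normr0 expr0n mulr0.
Qed.

(** Maximality half of Sylvester's law: a subspace of larger dimension would contain a nonzero
    vector orthogonal to all eigenvectors in [P] with negative eigenvalue, and the form is
    nonnegative there. *)
Lemma neg_definite_le (n k : nat) (A : 'M[algC]_n) (W : 'M_(k, n)) : A ^t* = A ->
  neg_definite_on A W -> (k <= neg_inertia A)%N.
Proof.
move=> /hermitian_diag [P [d [PPt defA dR]]] Wneg.
have Pu := unitarymx_unit (introT unitarymxP PPt).
have PA : P *m A = diag_mx d *m P by rewrite defA !mulmxA PPt mul1mx.
rewrite (neg_inertia_diag Pu PA); set J := [set i | _].
rewrite leqNgt; apply/negP => ltJ.
pose S : 'M[algC]_(n, #|J|) := \matrix_(i, a) (i == enum_val a)%:R.
pose K := kermx (W *m P ^t* *m S).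
have /rowV0Pn [u /sub_kermxP uK u0] : K != 0.
  by rewrite kermx_eq0 -row_leq_rank -ltnNge (leq_ltn_trans (rank_leq_col _)).
have := lt_geF (Wneg u u0); move/negbT/negP; apply.
have -> : u *m W = u *m W *m P ^t* *m P by rewrite -!mulmxA (mulmx1C PPt) mulmx1.
rewrite sqform_congr PA -[_ *m P *m _]mulmxA PPt mulmx1 sqform_diag.
apply: sumr_ge0 => i _; set y := u *m W *m _.
have [iJ|] := boolP (i \in J).
  have SE j : S j (enum_rank_in iJ i) = (j == i)%:R by rewrite mxE enum_rankK_in.
  have /rowP/(_ (enum_rank_in iJ i)) := uK.
  rewrite !mulmxA -/y [LHS]mxE [RHS]mxE (bigD1 i) //= SE eqxx mulr1.
  rewrite big1 ?addr0 => [->|j ji]; first by rewrite normr0 expr0n mulr0.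
  by rewrite SE (negPf ji) mulr0.
by rewrite inE -real_leNgt ?dR // => di; rewrite mulr_ge0 ?exprn_ge0.
Qed.

(** Intersecting a negative definite subspace of [A] with the hyperplane [x 0 w = 0], where the two
    forms agree, lowers its dimension by at most one. *)
Lemma hyperplane_neg_inertia (n : nat) (A B : 'M[algC]_n) (w : 'I_n) :
  A ^t* = A -> B ^t* = B ->
  (forall x : 'rV_n, x 0 w = 0 -> sqform B x = sqform A x) ->
  (neg_inertia A <= (neg_inertia B).+1)%N.
Proof.
move=> Ah Bh AB; have [W Wneg] := exists_neg_definite Ah.
pose K := kermx (W *m delta_mx w (0 : 'I_1)).
have KB : neg_definite_on B (row_base K *m W).
  move=> u u0; rewrite AB mulmxA.
    by apply: Wneg; rewrite mulmx_free_eq0 ?row_base_free.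
  have /sub_kermxP/rowP/(_ 0) : (u *m row_base K <= K)%MS.
    by rewrite mulmx_sub // eq_row_base.
  by rewrite !mulmxA -colE [LHS]mxE [RHS]mxE.
have := neg_definite_le Bh KB; rewrite mxrank_ker => leB.
have := rank_leq_col (W *m delta_mx w (0 : 'I_1)); lia.
Qed.

(** Matrix side of vertex deletion: row and column [w] are zeroed rather than removed, so that the
    size stays fixed. *)
Definition isolate_mx (n : nat) (A : 'M[algC]_n) (w : 'I_n) : 'M_n :=
  \matrix_(i, j) if (i == w) || (j == w) then 0 else A i j.

Lemma isolate_mxE (n : nat) (A : 'M[algC]_n) (w : 'I_n) (R := 1%:M - delta_mx w w) :
  isolate_mx A w = R *m A *m R.
Proof.
apply/matrixP => i j; rewrite mulmxBr mulmxBl mulmx1 mul1mx.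
have dA p (M : 'M[algC]_(n, p)) k m : (delta_mx w w *m M) k m = (k == w)%:R * M k m.
  rewrite mxE (bigD1 w) //= mxE eqxx andbT big1 ?addr0 => [|l lw].
    by case: eqP => [->|]; rewrite ?mul0r.
  by rewrite mxE (negPf lw) andbF mul0r.
have Ad p (M : 'M[algC]_(p, n)) k m : (M *m delta_mx w w) k m = M k m * (m == w)%:R.
  rewrite mxE (bigD1 w) //= mxE eqxx big1 ?addr0 => [|l lw].
    by case: eqP => [->|]; rewrite ?mulr0.
  by rewrite mxE (negPf lw) mulr0.
have sub (M N : 'M[algC]_n) k m : (M - N) k m = M k m - N k m by rewrite !mxE.
rewrite !sub !Ad !sub !dA mxE.
by case: eqP => [->|_]; case: eqP => [->|_] /=; ring.
Qed.

Lemma isolate_mx_herm (n : nat) (A : 'M[algC]_n) (w : 'I_n) :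
  A ^t* = A -> (isolate_mx A w) ^t* = isolate_mx A w.
Proof.
move=> Ah; apply/matrixP => i j; rewrite !mxE orbC.
by case: ifP => _; rewrite ?rmorph0 // -[in RHS]Ah !mxE.
Qed.

Lemma neg_inertia_isolate (n : nat) (A : 'M[algC]_n) (w : 'I_n) : A ^t* = A ->
  (neg_inertia A <= (neg_inertia (isolate_mx A w)).+1)%N.
Proof.
move=> Ah; apply: (hyperplane_neg_inertia (w := w)) => // [|x xw].
  exact: isolate_mx_herm.
rewrite isolate_mxE; set R := _ - _.
have RR : R ^t* = R.
  by rewrite linearB /= map_mxB trmx1 map_mx1 trmx_delta map_delta_mx.
rewrite -{2}RR -sqform_congr; congr sqform.
rewrite mulmxBr mulmx1 (_ : x *m _ = 0) ?subr0 //.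
apply/rowP => j; rewrite !mxE big1 // => k _; rewrite mxE.
by case: eqP => [->|_]; rewrite ?xw ?mul0r ?mulr0.
Qed.

(** Beyond [neg_inertia_isolate], one inequality remains: a negative definite subspace of largest
    dimension for [isolate_mx A w] is carried by a congruence into one for [A], then enlarged by a
    line. *)
Lemma neg_inertia_pendant (n : nat) (A : 'M[algC]_n) (l w : 'I_n) : A ^t* = A ->
  l != w -> A l w != 0 -> (forall j, j != w -> A l j = 0) ->
  neg_inertia A = (neg_inertia (isolate_mx A w)).+1.
Proof.
move=> Ah lw a0 Al; apply/eqP; rewrite eqn_leq neg_inertia_isolate //=.
have [N Nneg] := exists_neg_definite (isolate_mx_herm w Ah).
set a := A l w in a0.
(* F pulls A back to isolate_mx A w, and v spans a negative line A-orthogonal to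
   the image of F. *)
pose R : 'M[algC]_n := 1%:M - delta_mx w w.
pose F := R *m (1%:M - a^-1 *: (A *m delta_mx w l)).
(* Solves [A w w + 2 * s * a = -1], which makes the form equal to -1 at [v]; [s * a] is real because
   [A w w] is. *)
pose s := - (A w w + 1) / (2 * a).
pose v : 'rV[algC]_n := delta_mx 0 w + s *: delta_mx 0 l.
have RR : R ^t* = R.
  by rewrite linearB /= map_mxB trmx1 map_mx1 trmx_delta map_delta_mx.
have RE : R *m delta_mx w w = 0.
  by rewrite mulmxBl mul1mx mul_delta_mx subrr.
have Rlw : R *m delta_mx l w = delta_mx l w.
  by rewrite mulmxBl mul1mx mul_delta_mx_0 ?subr0 // eq_sym.
have defR : R = 1%:M - delta_mx w w by [].
have isoE : isolate_mx A w = R *m A *m R by rewrite isolate_mxE.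
clearbody R.
have lA : (delta_mx 0 l : 'rV_n) *m A = a *: delta_mx 0 w.
  apply/rowP => j; rewrite -rowE !mxE eqxx /=.
  by have [->|/Al ->] := eqVneq j w; rewrite ?mulr1 ?mulr0.
have DA : delta_mx w l *m A = a *: delta_mx w w.
  by rewrite -(mul_delta_mx (0 : 'I_1)) -mulmxA lA -scalemxAr mul_delta_mx.
(* Row [l] of [A] is [a] times the unit row at [w], so a correction of coordinate [l] clears column
   [w] of the product. *)
have FA : F *m A = R *m A *m R.
  rewrite /F -!mulmxA; congr (_ *m _).
  rewrite mulmxBl mul1mx -scalemxAl -mulmxA DA -scalemxAr scalerA mulVf // scale1r.
  by rewrite defR mulmxBr mulmx1.
have Al0 : A *m delta_mx l 0 = a^* *: (delta_mx w 0 : 'cV_n).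
  have -> : delta_mx l 0 = (delta_mx 0 l : 'rV_n)^t* :> 'M[algC]_(n, 1).
    by rewrite trmx_delta map_delta_mx.
  by rewrite -{1}Ah -trmxC_mul lA linearZ /= map_mxZ trmx_delta map_delta_mx.
have Alw : A *m delta_mx l w = a^* *: (delta_mx w w : 'M_n).
  by rewrite -(mul_delta_mx (0 : 'I_1)) mulmxA Al0 -scalemxAl mul_delta_mx.
have Ft : F ^t* = (1%:M - (a^-1)^* *: (delta_mx l w *m A)) *m R.
  rewrite trmxC_mul RR; congr (_ *m _).
  rewrite linearB /= map_mxB trmx1 map_mx1.
  by rewrite linearZ /= map_mxZ trmxC_mul Ah trmx_delta map_delta_mx.
have FAF : F *m A *m F ^t* = isolate_mx A w.
  rewrite FA isoE Ft.
  rewrite mulmxBl mul1mx mulmxBr -scalemxAl -!scalemxAr -!mulmxA.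
  rewrite [R *m (delta_mx _ _ *m _)]mulmxA Rlw.
  rewrite [A *m (delta_mx _ _ *m _)]mulmxA Alw -scalemxAl -scalemxAr.
  rewrite [R *m (delta_mx _ _ *m _)]mulmxA RE mul0mx !scaler0 subr0.
  by rewrite {3}defR mulmxBr mulmx1 RE subr0.
have vt : v ^t* = delta_mx w 0 + s^* *: delta_mx l 0.
  by rewrite linearD /= map_mxD linearZ /= map_mxZ !trmx_delta !map_delta_mx.
have FAv : F *m A *m v ^t* = 0.
  have R0 : R *m (delta_mx w 0 : 'cV_n) = 0.
    by rewrite -(mul_delta_mx w) mulmxA RE mul0mx.
  have Rl0 : R *m (delta_mx l 0 : 'cV_n) = delta_mx l 0.
    by rewrite -(mul_delta_mx w) mulmxA Rlw.
  rewrite FA vt -!mulmxA mulmxDr R0 add0r -scalemxAr Rl0 -scalemxAr Al0.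
  by rewrite -!scalemxAr R0 !scaler0.
have vAv : v *m A *m v ^t* = (-1)%:M.
  rewrite [LHS]mx11_scalar; congr (_%:M).
  have vA : v *m A = row w A + (s * a) *: delta_mx 0 w.
    by rewrite mulmxDl -scalemxAl lA scalerA -rowE.
  have -> : (v *m A *m v ^t*) 0 0 = A w w + s * a + s^* * a^*.
    have Awl : A w l = a^* by rewrite -Ah !mxE.
    rewrite vA vt mulmxDr -scalemxAr -!colE !mxE !eqxx (negPf lw) Awl /=.
    by rewrite mulr1 mulr0 addr0.
  have AwwR : (A w w)^* = A w w by rewrite -[in RHS]Ah !mxE.
  have saE : s * a = - (A w w + 1) / 2 by rewrite /s; field.
  have -> : s^* * a^* = s * a.
    rewrite -rmorphM saE rmorphM rmorphN rmorphD /= AwwR.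
    by rewrite rmorph1 fmorphV rmorph_nat.
  by rewrite saE; field.
have vAF : v *m A *m F ^t* = 0.
  have := congr1 (fun B => B ^t*) FAv.
  by rewrite !trmxC_mul Ah mulmxA trmx0 map_mx0 trmxCK.
clearbody F v; suff : neg_definite_on A (col_mx (N *m F) v).
  by move/(neg_definite_le Ah); rewrite addn1.
move=> u u0; rewrite -[u]hsubmxK mul_row_col.
have : (lsubmx u != 0) || (rsubmx u != 0).
  rewrite -negb_and; apply: contra u0 => /andP[/eqP x0 /eqP y0].
  by rewrite -[u]hsubmxK x0 y0 row_mx0.
move: (lsubmx u) (rsubmx u) => x y xy0.
have -> : sqform A (x *m (N *m F) + y *m v) =
    sqform (isolate_mx A w) (x *m N) - `|y 0 0| ^+ 2.
  rewrite mulmxA; move: (x *m N) => z.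
  have -> : `|y 0 0| ^+ 2 = (y *m y ^t*) 0 0.
    by rewrite [RHS]mxE big_ord1 !mxE normCK.
  have defZ : (z *m F + y *m v) ^t* = F ^t* *m z ^t* + v ^t* *m y ^t*.
    by rewrite linearD /= map_mxD !trmxC_mul.
  rewrite /sqform defZ mulmxDl mulmxDr !(mulmxDl (z *m _ *m _)).
  have -> : z *m F *m A *m (F ^t* *m z ^t*) = z *m isolate_mx A w *m z ^t*.
    by rewrite -FAF !mulmxA.
  have -> : y *m v *m A *m (F ^t* *m z ^t*) = y *m (v *m A *m F ^t*) *m z ^t*.
    by rewrite !mulmxA.
  have -> : z *m F *m A *m (v ^t* *m y ^t*) = z *m (F *m A *m v ^t*) *m y ^t*.
    by rewrite !mulmxA.
  have -> : y *m v *m A *m (v ^t* *m y ^t*) = y *m (v *m A *m v ^t*) *m y ^t*.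
    by rewrite !mulmxA.
  rewrite vAF FAv vAv !mulmx0 !mul0mx addr0 add0r mul_mx_scalar scaleN1r mulNmx.
  by rewrite [LHS]mxE; congr (_ + _); rewrite [LHS]mxE.
have Nz : x != 0 -> sqform (isolate_mx A w) (x *m N) < 0 by apply: Nneg.
have [x0|/Nz neg] := eqVneq x 0; last first.
  by rewrite subr_lt0 (lt_le_trans neg) // exprn_ge0.
rewrite x0 eqxx /= in xy0; rewrite x0 mul0mx /sqform !mul0mx mxE sub0r oppr_lt0.
rewrite exprn_gt0 // normr_gt0; apply: contra xy0 => /eqP y0.
by rewrite [y]mx11_scalar y0 raddf0.
Qed.
End Inertia.

(** * Vertex deletion in signed graphs *)

Section DeleteVertices.
Variables (V : finType) (G : signed_graph V).

Definition delete_rel (D : {set V}) : rel V :=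
  fun u v => [&& u \notin D, v \notin D & adj G u v].

Fact delete_sym D : symmetric (delete_rel D).
Proof. by move=> u v; rewrite /delete_rel adj_sym andbCA. Qed.

Fact delete_irrefl D : irreflexive (delete_rel D).
Proof. by move=> u; rewrite /delete_rel adj_irrefl !andbF. Qed.

(* The deleted vertices are kept, as isolated vertices, which only adds zero
   eigenvalues. *)
Definition delete_vertices (D : {set V}) : signed_graph V :=
  SignedGraph (SimpleGraph (@delete_sym D) (@delete_irrefl D)) (is_negative G).

Lemma adjacency_mx_herm : ((adjacency_mx G) ^t Num.conj)%sesqui = adjacency_mx G.
Proof.
apply/matrixP => i j; rewrite !mxE /= adj_sym setUC.
by case: ifP => _; rewrite ?rmorph0 // rmorphXn rmorphN1.
Qed.

Lemma negative_inertia_edgeless :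
  (forall u v, ~~ adj G u v) -> negative_inertia G = 0.
Proof.
move=> noE; have A0 : adjacency_mx G = 0%R.
  by apply/matrixP => i j; rewrite !mxE /= (negPf (noE _ _)).
have [W] := exists_neg_definite adjacency_mx_herm.
rewrite -[negative_inertia G]/(neg_inertia (adjacency_mx G)).
case: (neg_inertia _) W => // k W /(_ (delta_mx 0 ord0)%R).
rewrite A0 /sqform mulmx0 mul0mx mxE ltxx; case/(_ _)/notF.
by apply/eqP => /rowP/(_ ord0)/eqP; rewrite !mxE !eqxx oner_eq0.
Qed.
End DeleteVertices.

Lemma delete_vertices0 (V : finType) (G : signed_graph V) :
  negative_inertia (delete_vertices G set0) = negative_inertia G.
Proof.
rewrite /negative_inertia; congr (count _ (eigenvalues _)).
by apply/matrixP => i j; rewrite !mxE /= /delete_rel !inE.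
Qed.

Lemma adjacency_delete1 (V : finType) (G : signed_graph V) D x :
  adjacency_mx (delete_vertices G (x |: D)) =
  isolate_mx (adjacency_mx (delete_vertices G D)) (enum_rank x).
Proof.
apply/matrixP => i j; rewrite !mxE /= /delete_rel !inE !negb_or.
rewrite -!(can2_eq (@enum_valK V) (@enum_rankK V)).
by case: (_ == x); case: (_ == x); rewrite ?andbF.
Qed.

Lemma delete_vertex_le (V : finType) (G : signed_graph V) D x :
  negative_inertia (delete_vertices G D) <=
  (negative_inertia (delete_vertices G (x |: D))).+1.
Proof.
rewrite /negative_inertia adjacency_delete1.
exact: neg_inertia_isolate (adjacency_mx_herm _).
Qed.

Lemma delete_pendant (V : finType) (G : signed_graph V) (D : {set V}) l x :
    x \notin D -> l \notin D -> adj G l x ->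
    (forall v, v \notin D -> adj G l v -> v = x) ->
  negative_inertia (delete_vertices G D) =
  (negative_inertia (delete_vertices G (x |: D))).+1.
Proof.
move=> xD lD lx lonly; rewrite /negative_inertia adjacency_delete1.
apply: (@neg_inertia_pendant _ _ (enum_rank l)); first exact: adjacency_mx_herm.
- by rewrite (inj_eq enum_rank_inj); apply: contraTneq lx => ->; rewrite adj_irrefl.
- by rewrite mxE !enum_rankK /= /delete_rel xD lD lx signr_eq0.
move=> j jx; rewrite mxE enum_rankK /= /delete_rel; case: ifP => // /and3P[_ jD lj].
by rewrite -(lonly _ jD lj) enum_valK eqxx in jx.
Qed.

(** * Greedy pairing along a sequence and the parity of its runs *)

Section Runs.
Variables (T : Type) (M : pred T).

(* r is the parity of the part of the current unmarked run that precedes s; empty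
   runs and the run ending s are counted. *)
Fixpoint even_runs (r : bool) (s : seq T) : nat :=
  if s is x :: s' then
    if M x then ~~ r + even_runs false s' else even_runs (~~ r) s'
  else ~~ r.

(** Here [r] says that the preceding vertex is unmarked and was kept; it is then paired with [x] if
    [x] is unmarked, and left over if [x] is marked. *)
Fixpoint greedy_deletions (r : bool) (s : seq T) : seq T :=
  if s is x :: s' then
    if M x || r then x :: greedy_deletions false s' else greedy_deletions true s'
  else [::].

(** For [r = false]: a mark counts twice, and a run of length [L] contributes [L - 1], plus 1 if [L]
    is even. There is one more run than marks, whence the successor on the left. *)
Lemma size_greedy_deletions r s :
  (size (greedy_deletions r s)).*2.+1 = size s + even_runs r s + r.
Proof.
elim: s r => [|x s IHs] r /=; first by case: r.
case: (M x) r => -[] /=; move: (IHs false) (IHs true); lia.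
Qed.

Lemma even_runs_unmarked r s : ~~ has M s -> even_runs r s <= 1.
Proof. by elim: s r => [|x s IHs] r /=; [case: r | case: (M x) => //= /IHs]. Qed.
End Runs.

(** * Rotations of the cycle, and the paths between majors as runs *)

Section CyclicPaths.
Variables (V : finType) (G : simple_graph V).

Lemma rot_index_cat (T : eqType) (p q : seq T) x : uniq (p ++ x :: q) ->
  rot (index x (p ++ x :: q)) (p ++ x :: q) = x :: q ++ p.
Proof.
rewrite cat_uniq /= => /and3P[_ /norP[xp _] _].
by rewrite index_cat (negPf xp) /= eqxx addn0 rot_size_cat.
Qed.

Lemma rot_index_catC (T : eqType) (a b : seq T) x : uniq (a ++ b) -> x \in a ->
  rot (index x (b ++ a)) (b ++ a) = rot (index x (a ++ b)) (a ++ b).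
Proof.
move=> U xa; case/splitPr: xa U => a1 a2; rewrite -catA cat_cons => U.
rewrite rot_index_cat // catA rot_index_cat ?catA //.
by rewrite -catA uniq_catC -catA.
Qed.

Lemma rot_index_rot (T : eqType) n (c : seq T) x : uniq c -> x \in c ->
  rot (index x (rot n c)) (rot n c) = rot (index x c) c.
Proof.
rewrite -[rot n c]/(drop n c ++ take n c); move: (cat_take_drop n c).
move: (take n c) (drop n c) => a b <-; rewrite mem_cat => U /orP[] xs.
  exact: rot_index_catC.
by apply/esym/rot_index_catC => //; rewrite uniq_catC.
Qed.

Lemma next_cat_cons (T : eqType) (p q : seq T) x : uniq (p ++ x :: q) ->
  next (p ++ x :: q) x = head x (q ++ p).
Proof.
move=> U; rewrite -(next_rot (size p) U) rot_size_cat /=.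
by case: (q ++ p) => [|y s] /=; rewrite eqxx.
Qed.

Lemma filter_rot (T : eqType) (M : pred T) n (s : seq T) :
  filter M (rot n s) = rot (count M (take n s)) (filter M s).
Proof.
rewrite -[rot n s]/(drop n s ++ take n s) -[in filter M s](cat_take_drop n s).
by rewrite !filter_cat -size_filter rot_size_cat.
Qed.

Lemma major_rot n c : major G (rot n c) =1 major G c.
Proof.
move=> w; rewrite /major mem_rot; congr (_ && _).
by apply: eq_existsb => v; rewrite mem_rot.
Qed.

Lemma majors_rot n c :
  majors G (rot n c) = rot (count (major G c) (take n c)) (majors G c).
Proof. by rewrite /majors (eq_filter (major_rot n c)) filter_rot. Qed.

(** The paths depend only on the cyclic order; this allows the cycle to start at a major vertex. *)
Lemma num_even_paths_rot n c : uniq c ->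
  num_even_paths G (rot n c) = num_even_paths G c.
Proof.
move=> Uc; rewrite /num_even_paths /major_paths !count_map majors_rot.
rewrite (permP (permEl (perm_rot _ _))); apply: eq_in_count => w.
rewrite mem_filter => /andP[_ wc] /=; rewrite next_rot ?filter_uniq //.
by rewrite /strictly_between rot_index_rot.
Qed.

(** With a major vertex at the head, no path wraps around: the paths are exactly the maximal
    unmarked runs of [s], empty ones included. *)
Lemma num_even_paths_runs c w s : c = w :: s -> uniq c -> major G c w ->
  num_even_paths G c = even_runs (major G c) false s.
Proof.
move=> cE Uc Mw; rewrite /num_even_paths /major_paths count_map.
set f := preim _ _; set M := major G c in Mw *.
(* [t] is the whole run after [x]; [u] is empty or starts with the next major. The default [w] of
   [head] handles the return to the start of the cycle. *)
have fE p x t u : c = p ++ x :: t ++ u -> M x -> ~~ has M t -> M (head w u) ->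
    f x = ~~ odd (size t).
  move=> cE' Mx Mt My; rewrite /f /= /strictly_between.
  have filterE : majors G c = filter M p ++ x :: filter M u.
    rewrite /majors -/M {1}cE' filter_cat /= Mx filter_cat.
    by move: Mt; rewrite has_filter negbK => /eqP ->.
  have -> : next (majors G c) x = head w u.
    rewrite filterE next_cat_cons -?filterE ?filter_uniq //.
    case: u My {cE' filterE} (cE') => [|y u] /= My; last by rewrite My.
    by rewrite cE; case: p => [|v p] [<-] //= _; rewrite Mw.
  have -> : rot (index x c) c = x :: (t ++ u) ++ p.
    by rewrite cE' rot_index_cat // -cE'.
  rewrite /= -catA index_cat; case: ifP => [ht|_].
    by case/negP: Mt; apply/hasP; exists (head w u).
  (* For [u] empty the next major is [w], which heads [p]; if [p] is empty too, then [x] is the only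
     major and the search stops at the end of [t]. *)
  suff -> : index (head w u) (u ++ p) = 0 by rewrite addn0 take_size_cat.
  move: cE'; rewrite cE; case: u {My filterE} => [|y u] /=; last by rewrite eqxx.
  by case: p => [|v p] [] //= -> _; rewrite eqxx.
(* Induction on the unread part [u]: [x] is the last major met and [t] the part of its run read so
   far. *)
suff: forall u p x t, c = p ++ x :: t ++ u -> M x -> ~~ has M t ->
    count f (x :: filter M u) = even_runs M (odd (size t)) u.
  by move=> /(_ s [::] w [::] cE Mw isT) <-; rewrite /majors -/M {1}cE /= Mw.
have fc v l : count f (v :: l) = f v + count f l by [].
elim=> [|y u IHu] p x t cE' Mx Mt.
  by rewrite fc (fE p x t [::]) ?addn0.
rewrite [even_runs _ _ _]/= [filter _ _]/=; case: ifP => My; last first.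
  rewrite -[~~ odd _]/(odd (size t).+1) -(size_rcons t y).
  by rewrite -(IHu p x (rcons t y)) ?cat_rcons ?has_rcons ?My.
rewrite -(IHu (p ++ x :: t) y [::]) ?My //; last by rewrite -catA.
by rewrite fc (fE p x t (y :: u)).
Qed.
End CyclicPaths.

(** * Unicyclic graphs: cycle lengths and chords *)

Section Unicyclic.
Variables (V : finType) (G : simple_graph V).

Lemma next_next_neq (T : eqType) (c : seq T) x : 2 < size c -> uniq c -> x \in c ->
  next c (next c x) != x.
Proof.
move=> c3 Uc xc; have [i s rc] := rot_to xc.
rewrite -!(next_rot i Uc) rc; have := c3; rewrite -(size_rot i) rc.
have := Uc; rewrite -(rot_uniq i) rc; case: s {rc} => [|a [|b s]] //=.
rewrite !inE !negb_or => /and3P[/and3P[xa xb _] _ _] _.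
by rewrite eqxx [a == x]eq_sym (negPf xa) eqxx eq_sym.
Qed.

(** Two vertices defining the same edge would be successors of each other, which a cycle of length
    at least 3 excludes. *)
Lemma card_cycle_edges c : is_cycle G c -> #|cycle_edges c| = size c.
Proof.
case/and3P=> c3 Uc _; rewrite card_in_imset => [|x y xc yc]; first exact/card_uniqP.
move=> E; apply/eqP; apply: contraT => xy.
have : x \in [set y; next c y] by rewrite -E set21.
have : y \in [set x; next c x] by rewrite E set21.
rewrite !inE (negPf xy) eq_sym (negPf xy) /= => /eqP yx /eqP xny.
by case/negP: (next_next_neq c3 Uc xc); rewrite -yx -xny.
Qed.

Lemma unicyclic_size c c' : unicyclic G -> is_cycle G c -> is_cycle G c' ->
  size c = size c'.
Proof.
by case=> _ [c0 _ c0P] cyc cyc'; rewrite -!card_cycle_edges // !c0P.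
Qed.

(* A chord would close a strictly shorter cycle. *)
Lemma unicyclic_chordless c u v : unicyclic G -> is_cycle G c ->
  u \in c -> v \in c -> adj G u v -> v = next c u \/ v = prev c u.
Proof.
move=> uniG cyc uc vc uv; have /and3P[c3 Uc cycc] := cyc.
have [i s rc] := rot_to uc.
rewrite -(next_rot i Uc) -(prev_rot i Uc) rc.
have Us : uniq (u :: s) by rewrite -rc rot_uniq.
have vs : v \in s.
  move: vc; rewrite -(mem_rot i) rc inE => /predU1P[vu|//].
  by rewrite vu adj_irrefl in uv.
case/splitPr: vs rc Us => [[|a s1] s2] rc Us; first by left; rewrite /= eqxx.
case/lastP: s2 rc Us => [|s2 b] rc Us.
  right; rewrite -[LHS](prev_next Us) -cat_cons next_cat_cons //.
(* The chord closes the arc from [u] through [a] and [s1] to [v], which misses [b]. *)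
have cyc' : is_cycle G (rcons (u :: a :: s1) v).
  apply/and3P; split; first by rewrite /= size_rcons.
    by move: Us; rewrite -cat_cons -cat_rcons cat_uniq => /and3P[].
  move: cycc; rewrite -(rot_cycle i) rc /= rcons_cat cat_path /=.
  case/and3P=> -> /= p1 /andP[lv _].
  by rewrite !rcons_path p1 lv last_rcons adj_sym uv.
have := unicyclic_size uniG cyc cyc'.
by rewrite -(size_rot i c) rc /= !size_cat /= !size_rcons; lia.
Qed.
End Unicyclic.

(** * The greedy deletion carried out once around the cycle *)

Section DeleteAlongCycle.
Variables (V : finType) (G : signed_graph V) (c : seq V).
Hypothesis Uc : uniq c.
Hypothesis cyc : cycle (adj G) c.
Hypothesis chordless : forall u v, u \in c -> v \in c -> adj G u v ->
  v = next c u \/ v = prev c u.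
Hypothesis off_indep : forall u v, u \notin c -> v \notin c -> ~~ adj G u v.
Hypothesis off_one : forall v x y, v \notin c -> x \in c -> y \in c ->
  adj G v x -> adj G v y -> x = y.

Lemma nonmajor_neighbour u v : u \in c -> ~~ major G c u -> adj G u v ->
  v = next c u \/ v = prev c u.
Proof.
move=> uc Mu uv; apply: chordless => //; apply: contraNT Mu => vc.
by rewrite /major uc; apply/existsP; exists v; rewrite vc.
Qed.

(** Invariant of the walk: [y] was visited last, [s] is still to come, and every remaining edge
    meets [s]. If [y] was kept, its predecessor is gone and it has no leaves, so it is pendant at
    the first vertex of [s]. *)
Lemma delete_along_cycle (y : V) (s : seq V) (D : {set V}) :
    fpath (next c) y s -> y \in c -> next c (last y s) \in D ->
    {subset D <= c} -> uniq (y :: s) -> {in s, forall x, x \notin D} ->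
    (y \notin D -> ~~ major G c y /\ prev c y \in D) ->
    (forall u v, adj G u v -> u \notin D -> v \notin D -> (u \in s) || (v \in s)) ->
  negative_inertia (delete_vertices G D) =
  size (greedy_deletions (major G c) (y \notin D) s).
Proof.
elim: s y D => [|x s IHs] y D /=.
  move=> _ _ _ _ _ _ _ noE; apply: negative_inertia_edgeless => u v /=.
  by apply/and3P => -[uD vD uv]; have := noE u v uv uD vD.
case/andP=> /eqP yx pathx yc lastD Dc /and3P[/norP[yNx ys] xs Us] sD yP noE.
have xc : x \in c by rewrite -yx mem_next.
have xD : x \notin D by apply: sD; rewrite mem_head.
(* Any vertex [l] pendant at [x] pays for the deletion of [x]: a leaf if [x] is major, or [y] if [y]
   was kept. *)
have delx l : l \notin D -> adj G l x ->
      (forall v, v \notin D -> adj G l v -> v = x) ->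
    negative_inertia (delete_vertices G D) =
    (size (greedy_deletions (major G c) false s)).+1.
  move=> lD lx lonly; rewrite (delete_pendant xD lD lx lonly); congr _.+1.
  rewrite (IHs x (x |: D)) ?setU11 //.
  - by rewrite inE lastD orbT.
  - by move=> z; rewrite !inE => /predU1P[->|/Dc].
  - by rewrite /= xs.
  - move=> z zs; rewrite !inE negb_or sD ?inE ?zs ?orbT // andbT.
    by apply: contraNneq xs => <-.
  move=> u v uv; rewrite !inE !negb_or => /andP[ux uD] /andP[vx vD].
  by have := noE u v uv uD vD; rewrite !inE (negPf ux) (negPf vx).
case: ifP => [/orP[|yD]|/norP[Mx]].
- case/andP=> _ /existsP[l /andP[lc xl]].
  apply: (delx l) => [|| v vD lv]; first by apply: contra lc => /Dc.
    by rewrite adj_sym.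
  have vc : v \in c by apply: contraTT lv => /(off_indep lc).
  by apply: (off_one lc) => //; rewrite adj_sym.
- have [My pyD] := yP yD.
  apply: (delx y) => // [|v vD yv]; first by rewrite -yx next_cycle.
  have [->|vp] := nonmajor_neighbour yc My yv; first exact: yx.
  by rewrite vp pyD in vD.
(* Here [x] is kept. Its only possible remaining neighbour is its successor, which heads [s], or
   lies in [D] when [s] is empty. *)
rewrite negbK => yD; have pxy : prev c x = y by rewrite -yx prev_next.
have nbx v : adj G x v -> v \notin D -> v \in s.
  move=> xv vD; have [vE|vE] := nonmajor_neighbour xc Mx xv; last first.
    by rewrite vE pxy yD in vD.
  case: s pathx lastD {IHs delx ys xs Us sD noE} => [|z s] /=.
    by rewrite -vE (negPf vD).
  by case/andP=> /eqP <- _ _; rewrite vE mem_head.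
have := IHs x D pathx xc lastD Dc; rewrite xD; apply => //=.
- by rewrite xs.
- by move=> z zs; apply: sD; rewrite inE zs orbT.
- by rewrite pxy.
move=> u v uv uD vD; have := noE u v uv uD vD; rewrite !inE.
case/orP=> /predU1P[e|->]; rewrite ?orbT //.
  by rewrite e in uv; rewrite (nbx v) ?orbT.
by rewrite e adj_sym in uv; rewrite (nbx u).
Qed.

Lemma negative_inertia_delete_head w s : c = w :: s ->
  negative_inertia (delete_vertices G [set w]) =
  size (greedy_deletions (major G c) false s).
Proof.
move=> cE; have wc : w \in c by rewrite cE mem_head.
have := cycle_next Uc; rewrite {2}cE /= rcons_path => /andP[pathw lastw].
have := Uc; rewrite {1}cE => Us.
rewrite (delete_along_cycle (y := w) (s := s)) ?set11 //.
- by rewrite inE.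
- by move=> z /set1P->.
- by move=> z zs; rewrite inE; apply: contraTneq zs => ->; case/andP: Us.
move=> u v uv; rewrite !inE => uw vw.
have : (u \in c) || (v \in c).
  by apply: contraTT uv => /norP[]; apply: off_indep.
by rewrite cE !inE (negPf uw) (negPf vw).
Qed.

Lemma negative_inertia_major_head w s : c = w :: s -> major G c w ->
  (negative_inertia G).*2 = size c + num_even_paths G c.
Proof.
move=> cE Mw; rewrite (num_even_paths_runs cE) //.
have := size_greedy_deletions (major G c) false s.
rewrite -(negative_inertia_delete_head cE).
have /andP[wc /existsP[l /andP[lc wl]]] := Mw.
suff -> : negative_inertia G = (negative_inertia (delete_vertices G [set w])).+1.
  by rewrite cE /=; lia.
rewrite -(delete_vertices0 G) -[[set w]]setU0.
apply: (delete_pendant (l := l)); rewrite ?inE // 1?adj_sym // => v _ lv.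
have vc : v \in c by apply: contraTT lv => /(off_indep lc).
by apply: (off_one lc) => //; rewrite adj_sym.
Qed.

Lemma negative_inertia_no_major w s : c = w :: s -> ~~ has (major G c) c ->
  (negative_inertia G).*2 <= (size c).+1.
Proof.
move=> cE noM; have /(even_runs_unmarked false) : ~~ has (major G c) s.
  by apply: contra noM; rewrite {3}cE /= => ->; rewrite orbT.
have := size_greedy_deletions (major G c) false s.
rewrite -(negative_inertia_delete_head cE).
have := delete_vertex_le G set0 w; rewrite delete_vertices0 setU0.
by rewrite [size c](congr1 size cE) /=; lia.
Qed.
End DeleteAlongCycle.

Theorem theorem3p1 (V : finType) (G : signed_graph V) (c : seq V) (g : nat)
    (uniG : unicyclic G) (cycle_c : is_cycle G c) (canG : canonical G c)
    (girthG : is_girth G g) :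
  ((g = 1 %[mod 4] \/ g = 3 %[mod 4]) ->
     (negative_inertia G = uphalf g + 1 <->
      3 <= size (pendant_stars G c) /\ num_even_paths G c = 3)) /\
  ((g = 0 %[mod 4] \/ g = 2 %[mod 4]) ->
     (negative_inertia G = uphalf g + 1 <->
      2 <= size (pendant_stars G c) /\ num_even_paths G c = 2)).
Proof.
have [[c0 cyc0 c0g] _] := girthG.
have gE : g = size c by rewrite -c0g (unicyclic_size uniG cyc0 cycle_c).
have /and3P[c3 Uc cyc] := cycle_c.
have [off1 indep one] := canG.
(* All vertices off the cycle are at distance 1, so the conditions of [canonical] apply to every one
   of them. *)
have off_indep u v : u \notin c -> v \notin c -> ~~ adj G u v.
  by move=> uc vc; apply: indep; apply: off1.
have off_one v x y : v \notin c -> x \in c -> y \in c ->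
    adj G v x -> adj G v y -> x = y.
  move=> vc xc yc vx vy; have /eqP/cards1P[z zE] := one v (off1 v vc).
  have : x \in [set z] by rewrite -zE inE xc.
  have : y \in [set z] by rewrite -zE inE yc.
  by move=> /set1P-> /set1P->.
have chordless u v := @unicyclic_chordless V G c u v uniG cycle_c.
(* There is one path per star, so the lower bound on the number of stars follows from the count of
   even paths. *)
have even_le : num_even_paths G c <= size (pendant_stars G c).
  rewrite /num_even_paths (leq_trans (count_size _ _)) //.
  by rewrite /major_paths /pendant_stars !size_map.
have [/hasP[w wc Mw]|noM] := boolP (has (major G c) c).
  have [i s rc] := rot_to wc.
  (* Twice [uphalf g + 1] is [g + 3] for odd [g] and [g + 2] for even [g], so only the parity of [g]
     matters. *)
  suff : (negative_inertia G).*2 = g + num_even_paths G c.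
    split=> gmod; split=> [|[]]; lia.
  rewrite gE -(size_rot i) -(num_even_paths_rot G i Uc).
  apply: (negative_inertia_major_head _ _ _ _ _ rc);
    rewrite ?rot_uniq ?rot_cycle ?major_rot //.
  - by move=> u v; rewrite !mem_rot next_rot // prev_rot //; apply: chordless.
  - by move=> u v; rewrite !mem_rot; apply: off_indep.
  by move=> v x y; rewrite !mem_rot; apply: off_one.
(* Without majors both sides fail: there are no stars, and twice the inertia is at most [g + 1]. *)
have noE : size (pendant_stars G c) = 0.
  rewrite size_map size_filter; apply/eqP.
  by rewrite -leqn0 leqNgt -has_count.
have [w [s cE]] : exists w s, c = w :: s by case: (c) c3 => [//|w s] _; exists w, s.
have := negative_inertia_no_major Uc cyc chordless off_indep off_one cE noM.
by split=> gmod; split=> [|[]]; lia.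
Qed.
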